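(* Let $H$ be the Hamiltonian with the preferred-orientation coupling at every vertex of the equilateral metric graph formed by the vertices and edges of the regular dodecahedron, all edges having length $1$. Then the square roots $k$ of the eigenvalues $k^2$ of $H$ are, for large $k$, situated in the intervals $$\left(n\pi-\frac{5.51}{k}+\mathcal O\!\left(\frac1{k^2}\right),\; n\pi+\frac{5.51}{k}+\mathcal O\!\left(\frac1{k^2}\right)\right),\qquad n\in\mathbb Z .$$ That is, there exist constants $C,K>0$ such that for every $k\ge K$ for which $k^2$ is an eigenvalue of $H$ there is $n\in\mathbb Z$ with $$|k-n\pi|<\frac{5.51}{k}+\frac{C}{k^2}.$$
   Context: Graph: the metric graph whose vertices and edges are those of the given Platonic solid in $\mathbb R^3$; each of its $N$ edges is identified with the interval $(0,1)$ (the choice of direction of the identification is immaterial). Operator: $H$ acts on $\bigoplus_{e=1}^N L^2((0,1))$ as $f_e\mapsto -f_e''$ on every edge. Its domain consists of all functions in $\bigoplus_{e=1}^N W^{2,2}((0,1))$ satisfying, at every vertex $v$, the coupling condition $$(U_v-I)\Psi_v+i(U_v+I)\Psi_v'=0,$$ where $\Psi_v\in\mathbb C^d$ is the vector of boundary values at $v$ of the functions on the $d$ edges meeting at $v$ ($d$ is the degree of $v$), and $\Psi_v'\in\mathbb C^d$ is the vector of the corresponding outgoing derivatives, i.e. $f'(0)$ if $v$ corresponds to the endpoint $x=0$ of the edge, and $-f'(1)$ if $v$ corresponds to the endpoint $x=1$. Preferred-orientation coupling: at every vertex the edges are numbered $1,\dots,d$ consecutively in the clockwise cyclic order as seen from the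 exterior of the solid, and $U_v$ is the $d\times d$ cyclic permutation matrix with $(U_v)_{m,m+1}=1$ for $m=1,\dots,d-1$, $(U_v)_{d,1}=1$, and all other entries $0$. Explicitly, with cyclic indices, the coupling condition reads $\psi_{m+1}-\psi_m+i(\psi'_{m+1}+\psi'_m)=0$ for $m=1,\dots,d$. The operator $H$ is self-adjoint with purely discrete spectrum. Only positive eigenvalues $k^2$ with $k>0$ are considered. *)

(* Defs.v *)
From HB Require Import structures.
From mathcomp Require Import all_boot all_order all_algebra.
From mathcomp Require Import complex.
From mathcomp Require Import all_classical all_reals all_analysis.

Set Implicit Arguments.
Unset Strict Implicit.
Unset Printing Implicit Defensive.

Import Order.TTheory GRing.Theory Num.Theory.

Local Open Scope classical_set_scope.
Local Open Scope complex_scope.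
Local Open Scope ring_scope.

Section dodecahedron.
Variable R : realType.

Definition golden : R := (1 + Num.sqrt 5) / 2.

Definition vec3 (x y z : R) : 'rV[R]_3 := \row_(i < 3) [:: x; y; z]`_i.

(* The regular dodecahedron centred at the origin with edge length 2 / golden.
   Its size is irrelevant: every edge of the metric graph is identified with
   (0,1). *)
Definition vertex_list : seq 'rV[R]_3 :=
  let g := golden in let h := golden^-1 in
  [:: vec3 1 1 1; vec3 1 1 (-1); vec3 1 (-1) 1; vec3 1 (-1) (-1);
      vec3 (-1) 1 1; vec3 (-1) 1 (-1); vec3 (-1) (-1) 1; vec3 (-1) (-1) (-1);
      vec3 0 h g; vec3 0 h (-g); vec3 0 (-h) g; vec3 0 (-h) (-g);
      vec3 h g 0; vec3 h (-g) 0; vec3 (-h) g 0; vec3 (-h) (-g) 0;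
      vec3 g 0 h; vec3 (-g) 0 h; vec3 g 0 (-h); vec3 (-g) 0 (-h)].

Definition vertex := 'I_20.

Definition position (v : vertex) : 'rV[R]_3 := nth 0 vertex_list v.

Definition dist2 (p q : 'rV[R]_3) : R := \sum_(i < 3) (p 0 i - q 0 i) ^+ 2.

Definition adjacent (u v : vertex) : bool :=
  dist2 (position u) (position v) == (2 / golden) ^+ 2.

(* An edge is stored with its ends in increasing order; this fixes the
   identification with (0,1), the smaller end being x = 0. *)
Definition edge : Type :=
  {p : vertex * vertex | (p.1 < p.2)%N && adjacent p.1 p.2}.

Definition edge_src (e : edge) : vertex := (sval e).1.
Definition edge_tgt (e : edge) : vertex := (sval e).2.

Definition incident (v : vertex) (e : edge) : bool :=
  (v == edge_src e) || (v == edge_tgt e).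

Definition other_end (v : vertex) (e : edge) : vertex :=
  if v == edge_src e then edge_tgt e else edge_src e.

(* The solid is centred at the origin, so an exterior observer at the vertex p
   looks along -p; for him the turn from the edge p--q to the edge p--r by an
   angle in (0, pi) is clockwise iff det(p, q, r) < 0. *)
Definition clockwise_turn (p q r : 'rV[R]_3) : Prop :=
  \det (\matrix_(i < 3) nth 0 [:: p; q; r] i) < 0.

(* [ordS] is the cyclic successor on 'I_3; three consecutive clockwise turns,
   each by less than pi, add up to exactly one revolution. *)
Definition clockwise_numbering (v : vertex) (num : 'I_3 -> edge) : Prop :=
  [/\ injective num,
      forall e, incident v e <-> exists m, num m = e
    & forall m : 'I_3,
        clockwise_turn (position v) (position (other_end v (num m)))
                       (position (other_end v (num (ordS m))))].

End dodecahedron.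

Section sobolev.
Variable R : realType.
Local Notation mu := (@lebesgue_measure R).

Definition L2_01 (g : R -> R[i]) : Prop :=
  [/\ measurable_fun (`]0, 1[ : set R) (fun x => complex.Re (g x)),
      measurable_fun (`]0, 1[ : set R) (fun x => complex.Im (g x))
    & (\int[mu]_(x in `]0%R, 1%R[%classic)
         ((complex.Re (g x)) ^+ 2 + (complex.Im (g x)) ^+ 2)%:E < +oo)%E].

Definition complex_integral (D : set R) (g : R -> R[i]) : R[i] :=
  (\int[mu]_(x in D) complex.Re (g x)) +i*
  (\int[mu]_(x in D) complex.Im (g x)).

Definition primitive_01 (f g : R -> R[i]) : Prop :=
  forall x, 0 <= x <= 1 -> f x = f 0 + complex_integral `[0, x] g.

(* f is in W^{2,2}((0,1)), with f' = f1 and f'' = f2: f and f' are absolutely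
   continuous and f'' is in L^2.  A Sobolev function is represented by its C^1
   representative on [0,1], so that f 0, f 1, f1 0, f1 1 are its boundary
   values; f1 is determined by f on all of [0,1] and f2 almost everywhere.
   Values outside [0,1] are irrelevant. *)
Definition W22_01 (f f1 f2 : R -> R[i]) : Prop :=
  [/\ L2_01 f2, primitive_01 f1 f2 & primitive_01 f f1].

Definition eq_L2_01 (f g : R -> R[i]) : Prop :=
  {ae mu, forall x, 0 < x < 1 -> f x = g x}.

End sobolev.

Section hamiltonian.
Variable R : realType.
Variable num : vertex -> 'I_3 -> edge R.

Definition cyclic_mx (d : nat) : 'M[R[i]]_d := \matrix_(m, n) (n == ordS m)%:R.

Definition boundary_values (f : edge R -> R -> R[i]) (v : vertex) :
    'cV[R[i]]_3 :=
  \col_m (let e := num v m in if v == edge_src e then f e 0 else f e 1).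

Definition outgoing_derivatives (f1 : edge R -> R -> R[i]) (v : vertex) :
    'cV[R[i]]_3 :=
  \col_m (let e := num v m in if v == edge_src e then f1 e 0 else - f1 e 1).

Definition vertex_coupling d (U : 'M[R[i]]_d) (Psi Psi' : 'cV[R[i]]_d) : Prop :=
  (U - 1%:M) *m Psi + 'i%C *: ((U + 1%:M) *m Psi') = 0.

(* The graph of the operator H: f lies in the domain and h = H f. *)
Definition hamiltonian (f h : edge R -> R -> R[i]) : Prop :=
  exists f1 f2 : edge R -> R -> R[i],
    [/\ forall e, W22_01 (f e) (f1 e) (f2 e),
        forall v, vertex_coupling (cyclic_mx 3)
                    (boundary_values f v) (outgoing_derivatives f1 v)
      & forall e, eq_L2_01 (h e) (fun x => - f2 e x)].

Definition hamiltonian_eigenvalue (lambda : R[i]) : Prop :=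
  exists f h : edge R -> R -> R[i],
    [/\ hamiltonian f h,
        ~ (forall e, eq_L2_01 (f e) (fun=> 0))
      & forall e, eq_L2_01 (h e) (fun x => lambda * f e x)].

End hamiltonian.

(* Main.v *)
(** On each edge an eigenfunction is a combination of cos(kx) and sin(kx), so its
    value psi and outgoing derivative psi' at one end, and the outgoing
    derivative psi'_rev at the other end, satisfy
    [k sin(k) psi = psi'_rev + cos(k) psi'].
    In degree 3 the matrix [U + 1] is invertible, and the coupling becomes
    [psi'_m = i (psi_{m+1} - psi_{m+2})].  If X is the largest boundary value,
    then all |psi'| <= 2 X, hence [k |sin k| X <= 4 X]; and X > 0, as otherwise
    the eigenfunction vanishes.  So |sin k| <= 4 / k.
    Near 0 we have |sin d| >= (4/5) |d|, which gives |k - n pi| <= 5 / k. *)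

Require Import Defs.
From mathcomp Require Import all_boot all_order all_algebra.
From mathcomp Require Import complex.
From mathcomp Require Import all_classical all_reals all_analysis.
From mathcomp Require Import measurable_realfun.
From mathcomp Require Import ring lra.

Import Order.TTheory GRing.Theory Num.Theory.
Import numFieldNormedType.Exports.

Local Open Scope classical_set_scope.
Local Open Scope complex_scope.
Local Open Scope ring_scope.

(** * Locating [k] from the size of [sin k] *)

Lemma sin_subnpi (R : realType) (k : R) (n : nat) :
  `|sin (k - n%:R * pi)| = `|sin k|.
Proof.
rewrite -[in RHS](subrK (n%:R * pi) k) mulr_natl alternatingn; last exact: sinDpi.
by rewrite normrM normrX normrN1 expr1n mul1r.
Qed.

Lemma nearest_npi (R : realType) (k : R) : 0 <= k ->
  exists n : nat, `|k - n%:R * pi| <= pi / 2.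
Proof.
move=> k0; have p0 := pi_gt0 R.
(* Adding one half before truncating rounds [k / pi] to a nearest integer. *)
pose x := k / pi + 2^-1.
have x0 : 0 <= x by rewrite addr_ge0// divr_ge0// ltW.
have /andP[nx xn] := truncn_itv x0.
exists (Num.truncn x).
have kE : k = (x - 2^-1) * pi by rewrite /x addrK divfK// gt_eqF.
rewrite {1}kE -mulrBl normrM (gtr0_norm p0) mulrC ler_pM2l//.
rewrite -natr1 in xn; rewrite ler_norml; lra.
Qed.

(** By the mean value theorem [sin d = cos t * d] with [t] between 0 and [d], and [cos t > c] near 0
    by continuity. *)
Lemma sin_near0 (R : realType) (c : R) : c < 1 ->
  exists2 e : R, 0 < e <= pi / 2 & forall d, 0 <= d < e -> c * d <= sin d.
Proof.
move=> c1.
have p0 := pi_gt0 R.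
have : \forall x \near (0 : R), c < cos x.
  by have /cvgr_gt := @continuous_cos R 0; apply; rewrite cos0.
move=> /nbhs_ballP[e /= e0 he].
exists (Num.min e (pi / 2)).
  by rewrite lt_min e0 divr_gt0//= ge_min lexx orbT.
move=> d /andP[d0]; rewrite lt_min => /andP[de _].
have [|t /=] := @MVT_segment _ sin cos _ _ d0.
  by apply: continuous_subspaceT => x; exact: continuous_sin.
rewrite in_itv/= => /andP[t0 td]; rewrite sin0 !subr0 => ->.
rewrite ler_wpM2r// ltW//; apply: he.
by rewrite /ball/= sub0r normrN ger0_norm// (le_lt_trans td).
Qed.

(** Some multiple of [pi] lies within [pi / 2] of [k]. On [[0, pi / 2]] the sine increases, so a
    small sine forces a small distance, and there the linear lower bound on [sin] applies. *)
Lemma small_sin_near_npi (R : realType) (c b : R) : 0 < c < 1 -> 0 < b ->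
  exists2 K : R, 0 < K & forall k, K <= k -> `|sin k| <= b / k ->
    exists n : nat, `|k - n%:R * pi| <= (b / c) / k.
Proof.
move=> /andP[c0 c1] b0.
have [e /andP[e0 epi] he] := @sin_near0 R _ c1.
have p0 := pi_gt0 R.
have se : 0 < sin e by apply: sin_gt0_pi; rewrite e0/=; lra.
(* This choice makes [b / k] at most [sin e / 2], hence strictly below [sin e]. *)
exists (2 * b / sin e); first by rewrite divr_gt0// mulr_gt0.
move=> k Kk sk.
have k0 : 0 < k by apply: lt_le_trans Kk; rewrite divr_gt0// mulr_gt0.
have [n hn] := @nearest_npi R _ (ltW k0).
exists n; move: sk; rewrite -(sin_subnpi _ k n); set d := k - _ in hn *.
have -> : `|sin d| = sin `|d|.
  have [d0|d0] := leP 0 d.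
    by rewrite !ger0_norm//; apply: sin_ge0_pi; rewrite d0/=; move: hn; rewrite ger0_norm//; lra.
  rewrite ltr0_norm// in hn; rewrite (ltr0_norm d0) sinN ler0_norm//.
  by rewrite -oppr_ge0 -sinN; apply: sin_ge0_pi; lra.
move=> sk; have d0 := normr_ge0 d.
have de : `|d| < e.
  rewrite ltNge; apply/negP => ed.
  have : sin e <= sin `|d|.
    by rewrite leNgt ltr_sin ?in_itv/= -?leNgt//; lra.
  apply/negP; rewrite -ltNge; apply: le_lt_trans sk _.
  rewrite ltr_pdivrMr//; move: Kk; rewrite ler_pdivrMr//; nra.
have /he h : 0 <= `|d| < e by rewrite d0.
by rewrite mulrAC ler_pdivlMr// mulrC (le_trans h).
Qed.

(** * The equation g'' = -k^2 g on one edge, for Sobolev functions *)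

Section real_ode.
Variable R : realType.
Local Notation mu := (@lebesgue_measure R).

(** On a bounded interval square integrability gives integrability, because [|g| <= 1 + g ^+ 2]; the
    endpoints are null. The functions [a] and [b] are meant to be a real and an imaginary part, and
    [g] one of the two. *)
Lemma L2_integrable (g a b : R -> R) :
  measurable_fun (`]0, 1[ : set R) g -> measurable_fun (`]0, 1[ : set R) a ->
  measurable_fun (`]0, 1[ : set R) b ->
  (forall x, g x ^+ 2 <= a x ^+ 2 + b x ^+ 2) ->
  (\int[mu]_(x in `]0%R, 1%R[) (a x ^+ 2 + b x ^+ 2)%:E < +oo)%E ->
  mu.-integrable `[0, 1] (EFin \o g).
Proof.
move=> mg ma mb gab fin.
have mab : measurable_fun (`]0, 1[ : set R) (fun x => a x ^+ 2 + b x ^+ 2).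
  by apply: measurable_funD; exact: measurable_funX.
have iab : mu.-integrable `]0, 1[ (EFin \o (fun x => a x ^+ 2 + b x ^+ 2)).
  apply/integrableP; split; first exact/measurable_EFinP.
  under eq_integral => x _ do rewrite /= ger0_norm ?addr_ge0 ?sqr_ge0//.
  exact: fin.
have i1 : mu.-integrable `]0, 1[ (EFin \o cst (1 : R)).
  apply: (@integrableS _ _ _ mu `[0, 1]) => //.
    exact: subset_itv_oo_cc.
  apply: continuous_compact_integrable; first exact: segment_compact.
  by apply: continuous_subspaceT => x; exact: cvg_cst.
have ig : mu.-integrable `]0, 1[ (EFin \o g).
  apply: le_integrable (integrableD _ i1 iab) => //; first exact/measurable_EFinP.
  move=> x _ /=; rewrite lee_fin.
  rewrite [leRHS]ger0_norm ?addr_ge0 ?sqr_ge0//.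
  apply: (@le_trans _ _ (1 + g x ^+ 2)); last by rewrite lerD2l.
  by rewrite -real_normK ?num_real//; have := normr_ge0 (g x); nra.
have mgc : measurable_fun (`[0, 1] : set R) g by exact: measurable_fun_itv_cc mg.
apply/integrableP; split; first exact/measurable_EFinP.
case/integrableP : ig => _; rewrite integral_itv_obnd_cbnd; last first.
  by apply/measurable_EFinP; apply: measurableT_comp.
rewrite integral_itv_bndo_bndc//.
apply/measurable_EFinP; apply: measurableT_comp => //.
exact: measurable_fun_itv_co mg.
Qed.

Lemma primitive_continuous (g g1 : R -> R) :
  mu.-integrable `[0, 1] (EFin \o g1) ->
  (forall x, 0 <= x <= 1 -> g x = g 0 + \int[mu]_(t in `[0, x]) g1 t) ->
  {within `[0, 1], continuous g}.
Proof.
move=> ig1 gE.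
have c : {within `[0, 1], continuous
    (cst (g 0) + (fun x => parameterized_integral mu 0 x g1))}.
  apply: within_continuousD; first by apply: continuous_subspaceT => x; exact: cvg_cst.
  exact: parameterized_integral_continuous.
by apply: (subspace_eq_continuous _ c) => x; rewrite inE/= in_itv/= => /gE.
Qed.

Lemma primitive_is_derive (g g1 : R -> R) (x : R) :
  {within `[0, 1], continuous g1} ->
  (forall x, 0 <= x <= 1 -> g x = g 0 + \int[mu]_(t in `[0, x]) g1 t) ->
  x \in `]0, 1[ -> is_derive x 1 g (g1 x).
Proof.
move=> cg1 gE x01.
have ig1 : mu.-integrable `[0, 1] (EFin \o g1).
  by apply: continuous_compact_integrable => //; exact: segment_compact.
have cx : {for x, continuous g1} by apply: within_continuous_continuous cg1 x01.
move: (x01); rewrite in_itv/= => /andP[x0 x1].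
have [d1 d2] := continuous_FTC1_closed x1 ig1 x0 cx.
have dF : is_derive x 1 (fun y => g 0 + \int[mu]_(t in `[0, y]) g1 t) (g1 x).
  rewrite -[g1 x]add0r; apply: is_deriveD.
  by apply: DeriveDef => //; rewrite -d2 derive1E.
(* The integral formula for [g] is known only on [[0, 1]], which is a neighbourhood of the interior
   point [x]. *)
apply: near_eq_is_derive dF.
near=> y; rewrite [RHS]gE//.
apply/andP; split; apply: ltW.
- by near: y; exact: lt_nbhsr.
- by near: y; exact: lt_nbhsl.
Unshelve. all: by end_near. Qed.

Lemma derive0_cst (u : R -> R) :
  {within `[0, 1], continuous u} ->
  (forall x : R, x \in `]0, 1[%R -> is_derive x 1 u 0) ->
  forall x, 0 <= x <= 1 -> u x = u 0.
Proof.
move=> cu du x /andP[x0 x1].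
have [||c _] := @MVT_segment _ u (fun=> 0) _ _ x0.
- by move=> y; rewrite in_itv/= => /andP[y0 y1]; apply: du; rewrite in_itv/= y0 (lt_le_trans y1).
- by apply: continuous_subspaceW cu; apply: subset_itvl; rewrite bnd_simp.
- by rewrite mul0r => /eqP; rewrite subr_eq0 => /eqP.
Qed.

(* The solution formulas state that [k g cos(kx) - g' sin(kx)] and
   [k g sin(kx) + g' cos(kx)] are constant. *)
Lemma harmonic_edge (k : R) (g g1 g2 : R -> R) :
  mu.-integrable `[0, 1] (EFin \o g2) ->
  (forall x, 0 <= x <= 1 -> g1 x = g1 0 + \int[mu]_(t in `[0, x]) g2 t) ->
  (forall x, 0 <= x <= 1 -> g x = g 0 + \int[mu]_(t in `[0, x]) g1 t) ->
  {ae mu, forall x, 0 < x < 1 -> g2 x = - k ^+ 2 * g x} ->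
  forall x, 0 <= x <= 1 ->
    k * g x = k * g 0 * cos (k * x) + g1 0 * sin (k * x) /\
    g1 x = g1 0 * cos (k * x) - k * g 0 * sin (k * x).
Proof.
move=> ig2 g1E gE g2E.
have cg1 := primitive_continuous _ _ ig2 g1E.
have ig1 : mu.-integrable `[0, 1] (EFin \o g1).
  by apply: continuous_compact_integrable => //; exact: segment_compact.
have cg := primitive_continuous _ _ ig1 gE.
pose q x := - k ^+ 2 * g x.
have cq : {within `[0, 1], continuous q}.
  by move=> x; apply: cvgM; [exact: cvg_cst|exact: cg].
have iq : mu.-integrable `[0, 1] (EFin \o q).
  by apply: continuous_compact_integrable => //; exact: segment_compact.
(* [g2] equals the continuous [q] only almost everywhere; exchanging them under the integral makes
   [g1] differentiable at every interior point. *)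
have g1Eq x : 0 <= x <= 1 -> g1 x = g1 0 + \int[mu]_(t in `[0, x]) q t.
  move=> x01; rewrite g1E//; congr (_ + _); rewrite /Rintegral; congr fine.
  have sub : `[0, x] `<=` `[0, 1 : R].
    by apply: subset_itvl; rewrite bnd_simp; case/andP: x01.
  have restr h : mu.-integrable `[0, 1] h -> mu.-integrable `[0, x] h.
    by apply: integrableS.
  apply: ae_eq_integral => //.
  - by have /restr/integrableP[] := ig2.
  - by have /restr/integrableP[] := iq.
  have n0 : {ae mu, forall y : R, y != 0}.
    exists [set 0]; split => //; first exact: lebesgue_measure_set1.
    by move=> y /=; case: eqP.
  have n1 : {ae mu, forall y : R, y != 1}.
    exists [set 1]; split => //; first exact: lebesgue_measure_set1.
    by move=> y /=; case: eqP.
  have FF := ae_filter_ringOfSetsType mu.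
  apply: filterS3 g2E n0 n1 => y h y0 y1 /sub; rewrite /= in_itv/= => /andP[a b].
  by congr EFin; apply: h; rewrite !lt_neqAle a b eq_sym y0 y1.
have dg (x : R) : x \in `]0, 1[%R -> is_derive x 1 g (g1 x).
  exact: primitive_is_derive.
have dg1 (x : R) : x \in `]0, 1[%R -> is_derive x 1 g1 (q x).
  exact: primitive_is_derive.
have csin : {within `[0, 1], continuous (fun x => sin (k * x))}.
  apply: continuous_subspaceT => x.
  apply: (@continuous_comp _ _ _ ( *%R k) sin); first exact: mulrl_continuous.
  exact: continuous_sin.
have ccos : {within `[0, 1], continuous (fun x => cos (k * x))}.
  apply: continuous_subspaceT => x.
  apply: (@continuous_comp _ _ _ ( *%R k) cos); first exact: mulrl_continuous.
  exact: continuous_cos.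
have dk (x : R) : is_derive x 1 ( *%R k) k.
  have : is_derive x 1 (k *: @id R) (k *: 1) by apply: is_deriveZ.
  by rewrite /GRing.scale/= mulr1.
have dsin (x : R) : is_derive x 1 (fun x => sin (k * x)) (k * cos (k * x)).
  have := @is_derive1_comp _ sin ( *%R k) x _ _ (is_derive_sin _) (dk x).
  by rewrite mulrC.
have dcos (x : R) : is_derive x 1 (fun x => cos (k * x)) (k * (- sin (k * x))).
  have := @is_derive1_comp _ cos ( *%R k) x _ _ (is_derive_cos _) (dk x).
  by rewrite mulrC.
pose u x := k * g x * cos (k * x) - g1 x * sin (k * x).
pose w x := k * g x * sin (k * x) + g1 x * cos (k * x).
have [u0 w0] : u 0 = k * g 0 /\ w 0 = g1 0.
  by rewrite /u /w !mulr0 sin0 cos0 !mulr0 !mulr1 subr0 add0r.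
have uE : forall x, 0 <= x <= 1 -> u x = u 0.
  apply: derive0_cst.
    move=> x; apply: cvgB; apply: cvgM; [|exact: ccos|exact: cg1|exact: csin].
    by apply: cvgM; [exact: cvg_cst|exact: cg].
  move=> x x01.
  apply: (is_derive_eq (is_deriveB (is_deriveM (is_deriveM (is_derive_cst k x 1) (dg x x01)) (dcos x))
    (is_deriveM (dg1 x x01) (dsin x)))).
  by rewrite /GRing.scale/= /cst /q !fctE; ring.
have wE : forall x, 0 <= x <= 1 -> w x = w 0.
  apply: derive0_cst.
    move=> x; apply: cvgD; apply: cvgM; [|exact: csin|exact: cg1|exact: ccos].
    by apply: cvgM; [exact: cvg_cst|exact: cg].
  move=> x x01.
  apply: (is_derive_eq (is_deriveD (is_deriveM (is_deriveM (is_derive_cst k x 1) (dg x x01)) (dsin x))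
    (is_deriveM (dg1 x x01) (dcos x)))).
  by rewrite /GRing.scale/= /cst /q !fctE; ring.
(* Rotating back by the angle kx: k g = u cos(kx) + w sin(kx) and g1 = w cos(kx) - u sin(kx). *)
move=> x x01; rewrite -u0 -w0 -(uE x x01) -(wE x x01) /u /w.
have cs := cos2Dsin2 (k * x).
by split; rewrite -[LHS]mulr1 -cs; ring.
Qed.

End real_ode.

(** * Solving the vertex condition; real and imaginary parts *)

Section coupling.
Variable R : realType.

Lemma mul_cyclic_mx (P : 'cV[R[i]]_3) m : (cyclic_mx R 3 *m P) m 0 = P (ordS m) 0.
Proof.
rewrite mxE (bigD1 (ordS m))//= mxE eqxx mul1r big1 ?addr0// => j jm.
by rewrite mxE (negbTE jm) mul0r.
Qed.

(* Since U^3 = 1, (1 - U + U^2) / 2 is the inverse of U + 1. *)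
Lemma coupling_solved (Psi Psi' : 'cV[R[i]]_3) m :
  vertex_coupling (cyclic_mx R 3) Psi Psi' ->
  Psi' m 0 = 'i%C * (Psi (ordS m) 0 - Psi (ordS (ordS m)) 0).
Proof.
move=> /matrixP coup.
have E j : Psi (ordS j) 0 - Psi j 0 + 'i%C * (Psi' (ordS j) 0 + Psi' j 0) = 0.
  have := coup j 0.
  by rewrite mulmxBl mulmxDl !mul1mx mxE 2!mxE -mul_cyclic_mx -[Psi' (ordS j) 0]mul_cyclic_mx !mxE.
have S3 : ordS (ordS (ordS m)) = m by apply: val_inj; case: m => -[|[|[]]].
have := (E m, E (ordS m), E (ordS (ordS m))); rewrite S3 => -[[E0 E1] E2].
have i2 := sqr_i R.
have : 2 * Psi' m 0 = 2 * ('i%C * (Psi (ordS m) 0 - Psi (ordS (ordS m)) 0)).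
  (* This is row [m] of the condition after applying -i (1 - U + U^2); with U^3 = 1 it reads 2 Psi'
     - 2i (U - U^2) Psi = 0. *)
  have : - 'i%C * (Psi (ordS m) 0 - Psi m 0 + 'i%C * (Psi' (ordS m) 0 + Psi' m 0)
    - (Psi (ordS (ordS m)) 0 - Psi (ordS m) 0 + 'i%C * (Psi' (ordS (ordS m)) 0 + Psi' (ordS m) 0))
    + (Psi m 0 - Psi (ordS (ordS m)) 0 + 'i%C * (Psi' m 0 + Psi' (ordS (ordS m)) 0))) = 0.
    by rewrite E0 E1 E2; ring.
  move: (Psi m 0) (Psi (ordS m) 0) (Psi (ordS (ordS m)) 0).
  move: (Psi' m 0) (Psi' (ordS m) 0) (Psi' (ordS (ordS m)) 0) => a' b' c' a b c.
  move=> h; apply/eqP; rewrite -subr_eq0; apply/eqP; rewrite -h.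
  ring: i2.
by apply: mulfI; rewrite pnatr_eq0.
Qed.

(* Multiplication by i permutes the two parts up to sign, so the maximum of
   |Re| and |Im| is as good a norm as the modulus, and it stays inside R. *)
Definition part (b : bool) (z : R[i]) : R :=
  if b then complex.Re z else complex.Im z.

Lemma partB b z w : part b (z - w) = part b z - part b w.
Proof. by case: b; case: z; case: w. Qed.

Lemma partN b z : part b (- z) = - part b z.
Proof. by case: b; case: z. Qed.

Lemma norm_part_i b z : `|part b ('i%C * z)| = `|part (~~ b) z|.
Proof.
by case: b; case: z => x y; rewrite /= ?(mul0r, mul1r, add0r, sub0r, addr0) ?normrN.
Qed.

Lemma part_real b (a : R) z : part b (a%:C * z) = a * part b z.
Proof. by case: b; case: z => x y; rewrite /= mul0r ?subr0 ?addr0. Qed.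

(** Since [k ^+ 2] is real, the real and imaginary parts of an eigenfunction solve the real equation
    separately. *)
Lemma eigenfunction_edge (k : R) (f f1 f2 h : R -> R[i]) (b : bool) :
  W22_01 f f1 f2 -> eq_L2_01 h (fun x => - f2 x) ->
  eq_L2_01 h (fun x => (k ^+ 2)%:C * f x) ->
  forall x, 0 <= x <= 1 ->
    k * part b (f x) = k * part b (f 0) * cos (k * x) + part b (f1 0) * sin (k * x) /\
    part b (f1 x) = part b (f1 0) * cos (k * x) - k * part b (f 0) * sin (k * x).
Proof.
move=> [[mre mim fin] p1 p0] h1 h2.
apply: (harmonic_edge _ _ (part b \o f) (part b \o f1) (part b \o f2)) => //=.
- apply: (L2_integrable _ _ _ _ _ mre mim _ fin); first by case: b.
  by move=> x; case: b => /=; rewrite ?lerDl ?lerDr sqr_ge0.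
- by move=> x /p1 ->; rewrite /complex_integral; case: b; case: (f1 0).
- by move=> x /p0 ->; rewrite /complex_integral; case: b; case: (f 0).
have FF := ae_filter_ringOfSetsType (@lebesgue_measure R).
apply: filterS2 h1 h2 => x h1 h2 x01.
by rewrite -[f2 x]opprK -h1// h2// partN part_real mulNr.
Qed.

End coupling.

(** * The bound on [sin k] and the location of the eigenvalues *)

Lemma eigenvalue_sin (R : realType) (num : vertex -> 'I_3 -> edge R)
    (num_incident : forall v e, incident v e <-> exists m, num v m = e) (k : R) :
  0 < k ->
  hamiltonian_eigenvalue num ((k ^+ 2)%:C) -> `|sin k| <= 4 / k.
Proof.
move=> k0 [f [h [[f1 [f2 [W coup hf2]]] fN0 hf]]].
have kN0 : k != 0 by rewrite gt_eqF.
have sol e b := @eigenfunction_edge R k _ _ _ _ b (W e) (hf2 e) (hf e).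
pose psi v m b := part R b (boundary_values num f v m 0).
pose psi' v m b := part R b (outgoing_derivatives num f1 v m 0).
(* The factor i swaps the two parts, so the maximum below must range over both. *)
have psi'E v m b : `|psi' v m b| =
    `|psi v (ordS m) (~~ b) - psi v (ordS (ordS m)) (~~ b)|.
  by rewrite /psi' (coupling_solved _ _ _ _ (coup v)) norm_part_i partB.
have srcP e : exists m, num (edge_src e) m = e.
  by apply/num_incident; rewrite /incident eqxx.
have tgtP e : exists m, num (edge_tgt e) m = e.
  by apply/num_incident; rewrite /incident eqxx orbT.
have tgt_src (e : edge R) : (edge_tgt e == edge_src e) = false.
  by apply/negbTE; rewrite neq_ltn; have /andP[uv _] := svalP e; rewrite uv orbT.
have rev v m b : exists w n, k * sin k * psi v m b = psi' w n b + cos k * psi' v m b.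
  have [] := sol (num v m) b 1; rewrite ?ler01 ?lexx// !mulr1.
  move eE : (num v m) => e g1 dg1.
  have : incident v e by apply/num_incident; exists m.
  case/orP => /eqP vE.
  (* From the end x = 0 the identity is the derivative formula at x = 1. *)
  - have [n nE] := tgtP e; exists (edge_tgt e), n.
    by rewrite /psi /psi' !mxE /= nE eE tgt_src vE eqxx partN dg1; ring.
  (* From the end x = 1 the value formula is needed as well, together with cos^2 + sin^2 = 1. *)
  - have [n nE] := srcP e; exists (edge_src e), n.
    rewrite /psi /psi' !mxE /= nE eE vE tgt_src eqxx partN dg1.
    by rewrite mulrAC g1 -[X in _ = X + _]mulr1 -(cos2Dsin2 k); ring.
pose F (d : vertex * 'I_3 * bool) := `|psi d.1.1 d.1.2 d.2|.
case: (@Order.TotalTheory.arg_maxP _ _ _ (ord0, ord0, true) xpredT F isT) => -[[v m] b] _ vmax.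
have {}vmax w n c : `|psi w n c| <= F (v, m, b) by exact: (vmax (w, n, c)).
have psi'_le w n c : `|psi' w n c| <= 2 * F (v, m, b).
  by rewrite psi'E (le_trans (ler_normB _ _))// mulr_natl mulr2n lerD.
(* If the maximum were 0, all boundary values and hence all outgoing derivatives would vanish, and
   the solution formula would give zero on every edge. *)
have F0 : 0 < F (v, m, b).
  rewrite lt_neqAle normr_ge0 andbT eq_sym; apply: contra_notN fN0 => /eqP X0 e.
  have pE c x : 0 <= x <= 1 -> part R c (f e x) = 0.
    move=> /(sol e c)[+ _].
    have [n nE] := srcP e.
    have := psi'_le (edge_src e) n c; have := vmax (edge_src e) n c.
    rewrite X0 mulr0 !normr_le0 /psi /psi' !mxE /= nE eqxx => /eqP -> /eqP ->.
    by rewrite mulr0 !mul0r addr0 => /eqP; rewrite mulf_eq0 (negbTE kN0) => /eqP.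
  apply: aeW => x /andP[x0 x1].
  have x01 : 0 <= x <= 1 by rewrite !ltW.
  by have := (pE true x x01, pE false x x01); case: (f e x) => u w /= [-> ->].
have [w [n wn]] := rev v m b.
rewrite ler_pdivlMr// -(ler_pM2r F0).
have -> : `|sin k| * k * F (v, m, b) = `|k * sin k * psi v m b|.
  by rewrite !normrM (gtr0_norm k0) [`|sin k| * k]mulrC.
rewrite wn (le_trans (ler_normD _ _))// normrM.
have := cos_max k; have := psi'_le w n b; have := psi'_le v m b.
have := normr_ge0 (psi' v m b); have := normr_ge0 (cos k).
nra.
Qed.

Theorem theorem6p1 (R : realType) (num : vertex -> 'I_3 -> edge R)
    (num_clockwise : forall v : vertex, clockwise_numbering v (num v)) :
  exists C K : R, 0 < C /\ 0 < K /\
    forall k : R, K <= k ->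
      hamiltonian_eigenvalue num ((k ^+ 2)%:C) ->
      exists n : int,
        `|k - n%:~R * pi| < (551 / 100) / k + C / k ^+ 2.
Proof.
(* The slope 4/5 turns the bound 4/k into 5/k; as 5 < 5.51, the inequality is already strict and any
   positive [C] will do. *)
have [||K K0 near_npi] := @small_sin_near_npi R (4 / 5) 4; [lra|lra|].
exists 1, K; split; [lra|split=> // k Kk eig].
have k0 : 0 < k := lt_le_trans K0 Kk.
have num_incident v e : incident v e <-> exists m, num v m = e.
  by have [_ + _] := num_clockwise v; apply.
have [n hn] := near_npi _ Kk (eigenvalue_sin _ num num_incident _ k0 eig).
exists n; apply: le_lt_trans hn _.
rewrite -[ltLHS]addr0; apply: ltr_leD.
  by rewrite ltr_pM2r ?invr_gt0//; lra.
by rewrite divr_ge0// sqr_ge0.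
Qed.
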